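(* For all integers $d\geq 2$, (1) $B_d \geq d + \max(6,\lfloor \log_2(d)\rfloor)$, and (2) $C_d \geq d^2 + 4d + 1$. Furthermore, there are infinitely many integers $d\geq 2$ for which \[ C_d \ge d^2 + d\lfloor \log_2(d/4)\rfloor + 1. \]
   Context: For a field $K$ and $f(x)\in K[x]$, a point $\alpha$ is preperiodic under $f$ if its forward orbit $\{f^n(\alpha) : n\geq 0\}$ under iteration (composition) is finite; $\mathrm{PrePer}(f,K)$ is the set of $\alpha\in K$ preperiodic under $f$ (the point $\infty$ is not counted). For an integer $d\ge 2$ define, as elements of $[0,\infty]$, $B_d := \sup_f |\mathrm{PrePer}(f,\mathbb{Q})|$, the supremum over all $f(x) \in \mathbb{Q}[x]$ with $2 \leq \deg(f) \leq d$; and $C_d := \sup_{f,g}|\mathrm{PrePer}(f,\mathbb{C}) \cap \mathrm{PrePer}(g,\mathbb{C})|$, the supremum over all $f(x), g(x) \in \mathbb{C}[x]$ with $2 \leq \deg(f), \deg(g) \leq d$ such that $\mathrm{PrePer}(f,\mathbb{C}) \neq \mathrm{PrePer}(g,\mathbb{C})$. *)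

(* Defs.v *)
From mathcomp Require Import all_boot all_order all_algebra.
From mathcomp Require Import complex.
From mathcomp Require Import all_classical all_reals all_analysis.

Set Implicit Arguments.
Unset Strict Implicit.
Unset Printing Implicit Defensive.

Import Order.TTheory GRing.Theory Num.Theory.

Local Open Scope classical_set_scope.
Local Open Scope ring_scope.

Definition deg (K : fieldType) (f : {poly K}) : nat := (size f).-1.

Definition preperiodic (K : fieldType) (f : {poly K}) (a : K) : Prop :=
  finite_set (range (fun n : nat => iter n (horner f) a)).

Definition PrePer (K : fieldType) (f : {poly K}) : set K :=
  [set a | preperiodic f a].

(* [counting A] is the cardinality of [A], with value +oo when [A] is infinite.
   The real field [R] supplies the extended reals in which the suprema are taken
   and, for [Csup], the complex numbers [R[i]]. *)
Definition Bsup (R : realType) (d : nat) : \bar R :=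
  ereal_sup [set counting (PrePer f) | f in
    [set f : {poly rat} | (2 <= deg f <= d)%N]].

Definition Csup (R : realType) (d : nat) : \bar R :=
  ereal_sup [set counting (PrePer fg.1 `&` PrePer fg.2) | fg in
    [set fg : {poly R[i]} * {poly R[i]} |
      [/\ (2 <= deg fg.1 <= d)%N, (2 <= deg fg.2 <= d)%N
        & PrePer fg.1 <> PrePer fg.2]]].

Definition log2 (R : realType) (x : R) : R := ln x / ln 2.

(* Main.v *)
(** If a polynomial f of degree e >= 2 maps {0, ..., n-1} into {0, ..., n-2}, then
    f and f + 1 both preserve {0, ..., n-1}, so the n integers are preperiodic for
    f, and the f-preimages of {0, ..., n-2} are preperiodic for both f and f + 1.
    Since f has e - 1 critical points, there are at least e (n-1) - (e-1) such
    preimages. The two preperiodic sets differ: if both were equal to S, then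
    f @^-1` S = S and the surjectivity of f would give S + 1 `<=` S, whereas S is
    bounded.

    By Newton's forward formula, an integer sequence h on {0, ..., n-1} is
    interpolated by a polynomial of degree at most d as soon as its differences of
    orders d+1, ..., n-1 vanish at 0. For n = d + 6 an explicit sequence does it
    (with degree exactly d). For n = d + l with 2^l <= d, the pigeonhole principle
    gives two sequences with values in {0, ..., n/2 - 1} and equal differences of
    order d+1, and h is their difference. Its degree may be smaller than d, but it
    tends to infinity with d, which suffices for infinitely many degrees. *)

Require Import Defs.
From mathcomp Require Import all_boot all_order all_algebra.
From mathcomp Require Import complex.
From mathcomp Require Import all_classical all_reals all_analysis.
From mathcomp Require Import zify ring.

Set Implicit Arguments.
Unset Strict Implicit.
Unset Printing Implicit Defensive.

Import Order.TTheory GRing.Theory Num.Theory.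

Local Open Scope classical_set_scope.
Local Open Scope ring_scope.

(** * Common preperiodic points of f and f + 1 *)

Lemma preperiodic_invariant (K : fieldType) (f : {poly K}) (A : set K) (a : K) :
  finite_set A -> (forall x, A x -> A f.[x]) -> A a -> preperiodic f a.
Proof.
move=> finA fA Aa; apply: (sub_finite_set _ finA) => _ [n _ <-].
by elim: n => //= n; exact: fA.
Qed.

Lemma preperiodic_horner (K : fieldType) (f : {poly K}) (a : K) :
  preperiodic f f.[a] <-> preperiodic f a.
Proof.
split=> fina; last first.
  by apply: (sub_finite_set _ fina) => _ [n _ <-]; exists n.+1; rewrite ?iterSr.
apply: (@sub_finite_set _ _ ([set a] `|` range (fun n => iter n (horner f) f.[a]))).
  by move=> _ [[|n] _ <-]; [left|right; exists n; rewrite ?iterSr].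
by rewrite finite_setU; split; [exact: finite_set1|].
Qed.

(** Once |x| >= 1, the leading term minus the others is at least [(c * |x| - S) * |x| ^ d.+1], and
    the choice of [B] makes the first factor exceed 1. *)
Lemma horner_escape (K : numFieldType) (f : {poly K}) : (2 < size f)%N ->
  exists2 B : K, 0 <= B & forall x, B < `|x| -> `|x| < `|f.[x]|.
Proof.
move=> f2; have [d sf] : exists d, size f = d.+3.
  by exists (size f - 3)%N; rewrite -[LHS](subnK f2) addn3.
set c := `|f`_d.+2|; set S := \sum_(i < d.+2) `|f`_i|.
have S0 : 0 <= S by apply: sumr_ge0.
have c0 : 0 < c.
  rewrite normr_gt0 -[d.+2]/(d.+3.-1) -sf -lead_coefE lead_coef_eq0.
  by rewrite -size_poly_eq0 sf.
exists (1 + (S + 1) / c) => [|x Bx].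
  by rewrite addr_ge0 // divr_ge0 ?(ltW c0) // addr_ge0.
have x1 : 1 <= `|x|.
  apply/ltW/(le_lt_trans _ Bx); rewrite lerDl divr_ge0 ?(ltW c0) //.
  by rewrite addr_ge0.
have cx : S + 1 < c * `|x|.
  rewrite mulrC -ltr_pdivrMr //; apply: (le_lt_trans _ Bx); rewrite lerDr //.
have x0 : 0 < `|x| by apply: lt_le_trans x1.
have fx : c * `|x| ^+ d.+2 - S * `|x| ^+ d.+1 <= `|f.[x]|.
  rewrite horner_coef sf big_ord_recr /= [X in _ <= `|X|]addrC.
  apply: le_trans (lerB_normD _ _); rewrite normrM normrX lerD2l lerN2.
  apply: (le_trans (ler_norm_sum _ _ _)); rewrite /S mulr_suml.
  apply: ler_sum => i _; rewrite normrM normrX ler_wpM2l //.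
  by apply: ler_weXn2l => //; rewrite -ltnS ltn_ord.
apply: lt_le_trans fx; rewrite exprS mulrA -mulrBl.
apply: (@le_lt_trans _ _ (1 * `|x| ^+ d.+1)).
  by rewrite mul1r -{1}[`|x|]expr1; apply: ler_weXn2l.
by rewrite ltr_pM2r ?exprn_gt0 // ltrBrDl.
Qed.

(** Beyond the escape radius, absolute values increase strictly along the orbit, which is therefore
    infinite. *)
Lemma preperiodic_bounded (K : numFieldType) (f : {poly K}) : (2 < size f)%N ->
  exists2 B : K, 0 <= B & forall x, preperiodic f x -> ~~ (B < `|x|).
Proof.
move=> /horner_escape[B B0 fB]; exists B => // x prex; apply/negP => Bx.
pose u n := `|iter n (horner f) x|.
have uS n : B < u n /\ u n < u n.+1.
  elim: n => [|n [Bn nn]]; first by split => //; exact: fB.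
  by split; [exact: lt_trans nn|apply: fB; exact: lt_trans nn].
have uh : {homo u : m n / (m < n)%N >-> m < n}.
  by apply: homo_ltn => [y x' z|n]; [exact: lt_trans|case: (uS n)].
pose v n := iter n (horner f) x.
have injv : {in v @^-1` range v &, injective v}.
  move=> m n _ _ mn; have umn : u m = u n by rewrite /u -!/(v _) mn.
  by case: (ltngtP m n) => // /uh; rewrite umn ltxx.
by have := finite_preimage injv prex; rewrite preimage_range => /infinite_nat.
Qed.

Lemma counting_ge_size (T : choiceType) (R : realType) (A : set T) (s : seq T) :
  uniq s -> (forall x, x \in s -> A x) -> ((size s)%:R%:E <= counting A :> \bar R)%E.
Proof.
move=> us sA; rewrite /counting; case: asboolP => finA; last by rewrite leey.
rewrite lee_fin ler_nat; apply: uniq_leq_size => // x xs.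
by rewrite in_fset_set // inE; exact: sA.
Qed.


Lemma horner_surj (F : closedFieldType) (f : {poly F}) (y : F) :
  (1 < size f)%N -> exists x, f.[x] = y.
Proof.
move=> f1; have : size (f - y%:P) != 1%N.
  by rewrite size_polyDl ?size_polyN ?(leq_ltn_trans (size_polyC_leq1 _)) ?gtn_eqF.
by case/closed_rootP => x; rewrite rootE !hornerE subr_eq0 => /eqP <-; exists x.
Qed.

Lemma PrePer_add1_neq (R : realType) (f : {poly R[i]}) (a : R[i]) :
  (2 < size f)%N -> preperiodic f a -> PrePer f <> PrePer (f + 1).
Proof.
move=> f2 fa fE.
have fS y : preperiodic f y -> preperiodic f (y + 1).
  have [x <-] := horner_surj y (ltnW f2) => /preperiodic_horner fx.
  have gx : PrePer (f + 1) x by rewrite -fE.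
  have : PrePer (f + 1) (f.[x] + 1).
    have -> : f.[x] + 1 = (f + 1).[x] by rewrite hornerD hornerC.
    exact/preperiodic_horner.
  by rewrite -fE.
have fn n : preperiodic f (a + n%:R).
  by elim: n => [|n IH]; rewrite ?addr0 // -natr1 addrA; exact: fS.
have [B B0 fB] := preperiodic_bounded f2.
have aB : B + `|a| \is Num.real by rewrite realD ?ger0_real.
(* [B + |a|] is real but lives in [R[i]]; an integer [N] above it is found in [R], and then |a + N|
   >= N - |a| > B. *)
pose N := (Num.truncn (complex.Re (B + `|a|))).+1.
have BN : B + `|a| < N%:R.
  rewrite -(RRe_real aB) -(rmorph_nat (real_complex R)) ltcR.
  exact: truncnS_gt.
have /negP[] := fB _ (fn N).
have : `|N%:R : R[i]| - `|a| <= `|a + N%:R|.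
  by rewrite lerBlDr addrC -[X in `|X| <= _](addKr a) -[`|a|]normrN ler_normD.
by apply: lt_le_trans; rewrite ltrBrDr normr_nat.
Qed.

(** * Counting preimages through critical points *)

(** Differentiation lowers the multiplicity of a root by at most one, and the squarefree product
    over [undup rs] restores the lost factor. *)
Lemma prod_XsubC_dvdp_deriv (F : fieldType) (rs : seq F) :
  \prod_(z <- rs) ('X - z%:P) %|
    (\prod_(z <- rs) ('X - z%:P))^`() * \prod_(z <- undup rs) ('X - z%:P).
Proof.
elim: rs => [|z rs IH]; first by rewrite !big_nil dvd1p.
rewrite big_cons derivM derivXsubC mul1r [X in _ %| X]mulrDl.
set q := \prod_(z <- rs) ('X - z%:P) in IH *.
set r := \prod_(z <- undup rs) _ in IH *.
have H : ('X - z%:P) * q %| ('X - z%:P) * q^`() * r.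
  by rewrite -mulrA dvdp_mul2l ?polyXsubC_eq0.
rewrite /=; case: ifP => zrs; rewrite -/r.
   apply: dvdp_add => //; rewrite mulrC dvdp_mul // dvdp_XsubCl.
  by rewrite root_prod_XsubC mem_undup.
rewrite big_cons -/r; apply: dvdp_add.
  by rewrite mulrA mulrC [q * _]mulrC dvdp_mulr.
by rewrite mulrCA dvdp_mull.
Qed.

(* With F the product of the f - c, this is the divisibility F %| f^`() * rad F. *)
Lemma horner_preimages (F : numClosedFieldType) (f : {poly F}) (cs : seq F) :
  (1 < size f)%N -> uniq cs ->
  exists s : seq F, [/\ uniq s, {in s, forall x, f.[x] \in cs} &
    ((size f).-1 * size cs < size s + (size f).-1)%N].
Proof.
move=> f1 ucs.
have sfc c : size (f - c%:P) = size f.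
  by rewrite size_polyDl ?size_polyN ?(leq_ltn_trans (size_polyC_leq1 _)).
have fc0 c : f - c%:P != 0 by rewrite -size_poly_gt0 sfc (ltnW f1).
pose G ds := \prod_(c <- ds) (f - c%:P).
have G0 ds : G ds != 0.
  by rewrite prodf_seq_neq0; apply/allP => c _; rewrite fc0.
have rootG ds x : root (G ds) x = (f.[x] \in ds).
  elim: ds => [|c ds IH]; first by rewrite /G big_nil (negPf (root1 x)) in_nil.
  rewrite /G big_cons rootM IH inE.
  by rewrite rootE !hornerE subr_eq0.
have [rs GE] := closed_field_poly_normal (G cs).
have rsP x : (x \in rs) = (f.[x] \in cs).
  by rewrite -rootG GE rootZ ?lead_coef_eq0 // root_prod_XsubC.
exists (undup rs); split; rewrite ?undup_uniq //.
  by move=> x; rewrite mem_undup rsP.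
pose T := \prod_(z <- undup rs) ('X - z%:P).
have fcT c : c \in cs -> f - c%:P %| f^`() * T.
  move=> ccs; have [rc fcE] := closed_field_poly_normal (f - c%:P).
  have lc0 : lead_coef (f - c%:P) != 0 by rewrite lead_coef_eq0.
  have -> : f^`() = (f - c%:P)^`() by rewrite derivB derivC subr0.
  rewrite fcE derivZ -scalerAl dvdpZl // dvdpZr //.
  apply: (dvdp_trans (prod_XsubC_dvdp_deriv rc)); apply: dvdp_mul => //.
  apply: uniq_roots_dvdp; last by rewrite uniq_rootsE undup_uniq.
  apply/allP => x; rewrite mem_undup root_prod_XsubC mem_undup rsP => xrc.
  suff : root (f - c%:P) x by rewrite rootE !hornerE subr_eq0 => /eqP ->.
  by rewrite fcE rootZ // root_prod_XsubC.
(* Distinct fibres share no point, so the factors f - c are pairwise coprime and their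
   divisibilities combine. *)
have GT ds : uniq ds -> {subset ds <= cs} -> G ds %| f^`() * T.
  elim: ds => [|c ds IH] /=; first by rewrite /G big_nil dvd1p.
  move=> /andP[cds uds] dscs; rewrite /G big_cons Gauss_dvdp.
    rewrite fcT ?dscs ?mem_head //= IH // => x xds.
    by rewrite dscs // inE xds orbT.
  rewrite -/(G ds); apply: contraT => ncop.
  have /closed_rootP[x] : size (gcdp (f - c%:P) (G ds)) != 1%N by [].
  rewrite root_gcd rootG rootE !hornerE subr_eq0 => /andP[/eqP -> cd].
  by rewrite cd in cds.
have f'0 : f^`() != 0.
  apply/eqP => /(congr1 (coefp (size f).-2)); rewrite /= coef0 coef_deriv.
  move/eqP; rewrite mulrn_eq0 /= prednK -?lead_coefE ?lead_coef_eq0.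
    by rewrite -size_poly_eq0; case: (size f) f1.
  by case: (size f) f1 => [|[]].
have T0 : T != 0 by rewrite monic_neq0 // monic_prod_XsubC.
have f'lt : (size f^`() < size f)%N.
  by rewrite lt_size_deriv // -size_poly_gt0 ltnW.
have := dvdp_leq (mulf_neq0 f'0 T0) (GT cs ucs (fun _ => id)).
rewrite size_mul // size_prod_XsubC addnS /=.
have -> : size (G cs) = ((size f).-1 * size cs).+1.
  elim: (cs) => [|c ds IH]; first by rewrite /G big_nil size_poly1 muln0.
  have -> : G (c :: ds) = (f - c%:P) * G ds by rewrite /G big_cons.
  rewrite size_mul // IH sfc /= mulnS addnS /=.
  by rewrite -addSn prednK // ltnW.
by move=> /leq_trans; apply; rewrite addnC leq_add2l -ltnS prednK // ltnW.
Qed.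

Lemma nat_range_preperiodic (K : numFieldType) (n : nat) (f : {poly K}) (j : nat) :
  (forall j, (j < n)%N -> exists2 i, (i < n)%N & f.[j%:R] = i%:R) ->
  (j < n)%N -> preperiodic f j%:R.
Proof.
move=> fn jn; pose A : set K := [set i%:R | i in `I_n].
apply: (@preperiodic_invariant _ _ A); last by exists j.
  exact/finite_image/finite_II.
by move=> _ [k kn <-]; have [i ni ->] := fn k kn; exists i.
Qed.

(** * From self-maps of an integer interval to bounds on the suprema *)

Lemma Bsup_ge (R : realType) (d n : nat) (f : {poly rat}) :
  (2 <= deg f <= d)%N ->
  (forall j, (j < n)%N -> exists2 i, (i < n)%N & f.[j%:R] = i%:R) ->
  (n%:R%:E <= Bsup R d)%E.
Proof.
move=> fd fn; apply: (@le_trans _ _ (counting (PrePer f))); last first.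
  by apply: ereal_sup_ubound; exists f.
rewrite -{1}(size_iota 0 n) -(size_map (fun j : nat => j%:R : rat)).
apply: counting_ge_size.
  rewrite map_inj_uniq ?iota_uniq // => i j /eqP.
  by rewrite eqr_nat => /eqP.
move=> x /mapP[j]; rewrite mem_iota add0n /= => jn ->.
exact: nat_range_preperiodic fn jn.
Qed.

(** The invariant interval is {0, ..., n}, with [n + 1] elements. Points that f sends into {0, ...,
    n-1} are sent by f + 1 into {1, ..., n}; the critical points cost [deg f - 1]. *)
Lemma Csup_ge (R : realType) (d n m : nat) (f : {poly R[i]}) :
  (2 <= deg f <= d)%N ->
  (forall j, (j <= n)%N -> exists2 i, (i < n)%N & f.[j%:R] = i%:R) ->
  (m + deg f <= deg f * n + 1)%N ->
  (m%:R%:E <= Csup R d)%E.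
Proof.
move=> fd fn mn; have f2 : (2 < size f)%N.
  by move: fd; rewrite /deg => /andP[]; case: (size f).
have f_pre j : (j <= n)%N -> preperiodic f j%:R.
  rewrite -ltnS; apply: nat_range_preperiodic => k kn.
  by have [i ni ->] := fn k kn; exists i => //; exact: ltnW.
have g_pre j : (j <= n)%N -> preperiodic (f + 1) j%:R.
  rewrite -ltnS; apply: nat_range_preperiodic => k kn.
  by have [i ni fk] := fn k kn; exists i.+1; rewrite // hornerD hornerC fk natr1.
have sg : size (f + 1) = size f.
  by rewrite size_polyDl // size_poly1 ltnW.
have [|s [us sf ss]] := @horner_preimages _ f [seq j%:R | j <- iota 0 n] (ltnW f2).
  rewrite map_inj_uniq ?iota_uniq // => i j /eqP.
  by rewrite eqr_nat => /eqP.
apply: (@le_trans _ _ (counting (PrePer f `&` PrePer (f + 1)))); last first.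
  apply: ereal_sup_ubound; exists (f, f + 1) => //=.
  by split=> //; [rewrite /deg sg|exact: PrePer_add1_neq (f_pre 0%N _)].
apply: (@le_trans _ _ (size s)%:R%:E).
  rewrite lee_fin ler_nat -(leq_add2r (deg f)); apply: leq_trans mn _.
  by rewrite addn1; move: ss; rewrite size_map size_iota.
apply: counting_ge_size => // x /sf /mapP[j]; rewrite mem_iota add0n /= => jn fx.
split; apply/preperiodic_horner.
  by rewrite fx; exact/f_pre/ltnW.
by rewrite hornerD hornerC fx natr1; exact: g_pre.
Qed.

(** * Finite differences *)

Definition fdiff (V : zmodType) (h : nat -> V) (j : nat) : V := h j.+1 - h j.

Lemma eq_in_fdiff (V : zmodType) (g h : nat -> V) i j :
  (forall k, (j <= k <= j + i)%N -> g k = h k) ->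
  iter i (@fdiff V) g j = iter i (@fdiff V) h j.
Proof.
elim: i j => [|i IH] j gh /=; first by rewrite gh // addn0 leqnn.
by rewrite /fdiff !IH // => k /andP[jk ki]; rewrite gh //; lia.
Qed.

Lemma eq_fdiff (V : zmodType) (g h : nat -> V) i j :
  g =1 h -> iter i (@fdiff V) g j = iter i (@fdiff V) h j.
Proof. by move=> gh; apply: eq_in_fdiff. Qed.

Lemma iter_fdiffS (V : zmodType) (h : nat -> V) i j :
  iter i (@fdiff V) (fun k => h k.+1) j = iter i (@fdiff V) h j.+1.
Proof. by elim: i j => [|i IH] j //=; rewrite /fdiff !IH. Qed.

Lemma iter_fdiffD (V : zmodType) (g h : nat -> V) i j :
  iter i (@fdiff V) (fun k => g k + h k) j =
  iter i (@fdiff V) g j + iter i (@fdiff V) h j.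
Proof.
by elim: i j => [|i IH] j //=; rewrite /fdiff !IH opprD addrACA.
Qed.

Lemma raddf_iter_fdiff (U V : zmodType) (phi : {additive U -> V})
  (h : nat -> U) i j :
  iter i (@fdiff V) (fun k => phi (h k)) j = phi (iter i (@fdiff U) h j).
Proof. by elim: i j => [|i IH] j //=; rewrite /fdiff !IH raddfB. Qed.

(** Each further difference keeps the zeros and loses one place, so [r] consecutive zeros in order
    [m] yield zeros at 0 in [r] consecutive orders. *)
Lemma iter_fdiff_vanish (V : zmodType) (h : nat -> V) s r m :
  (forall k, (k < r)%N -> iter m (@fdiff V) h k = 0) ->
  (s < r)%N -> iter (m + s) (@fdiff V) h 0 = 0.
Proof.
move=> hm sr; suff H k : (k + s < r)%N -> iter (s + m) (@fdiff V) h k = 0.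
  by rewrite addnC H.
elim: s {sr} k => [|s IH] k ksr /=; first by rewrite hm // -(addn0 k).
by rewrite /fdiff !IH ?subrr // ?addSn -?addnS // (leq_trans _ ksr) // addnS.
Qed.

(** Induction on [j] for the shifted sequence, closed by Pascal's rule. *)
Lemma newton_forward (V : zmodType) (h : nat -> V) j m : (j < m)%N ->
  h j = \sum_(i < m) iter i (@fdiff V) h 0 *+ 'C(j, i).
Proof.
elim: j h m => [|j IH] h [|m] // jm.
  by rewrite big_ord_recl big1 ?addr0 // => i _; rewrite bin0n mulr0n.
rewrite (IH (fun k => h k.+1) m.+1 (ltnW jm)).
rewrite (eq_bigr (fun i : 'I_m.+1 => iter i (@fdiff V) h 0 *+ 'C(j, i) +
  iter i.+1 (@fdiff V) h 0 *+ 'C(j, i))); last first.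
  by move=> i _; rewrite iter_fdiffS -mulrnDl /= /fdiff addrC subrK.
rewrite big_split /= big_ord_recl [X in _ + X]big_ord_recr /=.
rewrite (@bin_small j m) // mulr0n addr0 !bin0.
rewrite [RHS]big_ord_recl !bin0 -addrA -big_split; congr (_ + _).
by apply: eq_bigr => i _; rewrite !lift0 /= -mulrnDr -binS.
Qed.

Section Newton.
Variable F : numFieldType.

(** The binomial coefficient C(X, i) as a polynomial in X. *)
Definition binp (i : nat) : {poly F} :=
  (i`!%:R)^-1 *: \prod_(j < i) ('X - (j%:R)%:P).

Lemma horner_binp i m : (binp i).[m%:R] = 'C(m, i)%:R.
Proof.
rewrite hornerZ.
have -> : (\prod_(j < i) ('X - (j%:R)%:P)).[m%:R] = (m ^_ i)%:R :> F.
  elim: i => [|i IH]; first by rewrite big_ord0 hornerC ffactn0.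
  rewrite big_ord_recr hornerM IH hornerXsubC ffactnSr natrM /=.
  have [im|mi] := leqP i m; first by rewrite natrB.
  by rewrite ffact_small // !mul0r.
by rewrite -bin_ffact natrM mulrC mulfK // pnatr_eq0 -lt0n fact_gt0.
Qed.

Lemma size_binp i : size (binp i) = i.+1.
Proof.
rewrite size_scale ?invr_eq0 ?pnatr_eq0 -?lt0n ?fact_gt0 //.
by rewrite size_prod_XsubC /index_enum -enumT size_enum_ord.
Qed.

Lemma coef_binp i : (binp i)`_i = (i`!%:R)^-1.
Proof.
rewrite coefZ; have /monicP := monic_prod_XsubC (index_enum 'I_i) predT
  (fun j : 'I_i => j%:R : F).
rewrite lead_coefE size_prod_XsubC /index_enum -enumT size_enum_ord /= => ->.
by rewrite mulr1.
Qed.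

Definition newton_poly (h : nat -> F) (d : nat) : {poly F} :=
  \sum_(i < d.+1) iter i (@fdiff F) h 0 *: binp i.

Lemma size_newton_poly h d : (size (newton_poly h d) <= d.+1)%N.
Proof.
apply: (leq_trans (size_sum _ _ _)); apply/bigmax_leqP => i _.
by apply: (leq_trans (size_scale_leq _ _)); rewrite size_binp.
Qed.

Lemma coef_newton_poly h d :
  (newton_poly h d)`_d = iter d (@fdiff F) h 0 / d`!%:R.
Proof.
rewrite /newton_poly big_ord_recr /= coefD coefZ coef_binp.
rewrite nth_default ?add0r //.
apply: (leq_trans (size_sum _ _ _)); apply/bigmax_leqP => i _.
by apply: (leq_trans (size_scale_leq _ _)); rewrite size_binp.
Qed.

Lemma horner_newton_poly h d j :
  (forall i, (d < i <= j)%N -> iter i (@fdiff F) h 0 = 0) ->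
  (newton_poly h d).[j%:R] = h j.
Proof.
move=> h0; rewrite horner_sum.
under eq_bigr do rewrite hornerZ horner_binp mulr_natr.
have [jd|dj] := leqP j d; first by rewrite -newton_forward.
rewrite [RHS](@newton_forward _ h j j.+1) //.
pose t i := iter i (@fdiff F) h 0 *+ 'C(j, i).
rewrite (big_ord_widen j.+1 t) ?ltnS 1?ltnW // /t.
rewrite big_mkcond /=; apply: eq_bigr => i _; case: ltnP => // di.
by rewrite h0 ?mul0rn // di -ltnS ltn_ord.
Qed.

(** Interpolation at [k + 1] points recovers [p], so the top coefficients agree. *)
Lemma iter_fdiff_horner (p : {poly F}) k : (size p <= k.+1)%N ->
  iter k (@fdiff F) (fun j => p.[j%:R]) 0 = p`_k *+ k`!.
Proof.
move=> sp; pose h (j : nat) := p.[j%:R].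
have pE : p = newton_poly h k.
  apply/eqP; rewrite -subr_eq0; apply/eqP.
  apply: (@roots_geq_poly_eq0 _ _ [seq j%:R | j <- iota 0 k.+1]).
  - apply/allP => x /mapP[j]; rewrite mem_iota /= ltnS => jk {x}->.
    rewrite rootE !hornerE horner_newton_poly ?subrr // => i /andP[ki ij].
    by have := leq_trans ki (leq_trans ij jk); rewrite ltnn.
  - rewrite map_inj_uniq ?iota_uniq // => i j /eqP; rewrite eqr_nat.
    by move/eqP.
  rewrite size_map size_iota (leq_trans (size_polyD _ _)) // geq_max sp.
  by rewrite size_polyN size_newton_poly.
by rewrite [in RHS]pE coef_newton_poly -[RHS]mulr_natr divfK.
Qed.
End Newton.

Lemma iter_fdiffMl (R : pzRingType) (c : R) (h : nat -> R) i j :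
  iter i (@fdiff R) (fun k => c * h k) j = c * iter i (@fdiff R) h j.
Proof. by elim: i j => [|i IH] j //=; rewrite /fdiff !IH mulrBr. Qed.

Lemma int_newton_poly (F : numFieldType) (h : nat -> int) (n d : nat) :
  (forall i, (d < i < n)%N -> iter i (@fdiff int) h 0 = 0) ->
  exists f : {poly F}, [/\ (size f <= d.+1)%N,
    f`_d = (iter d (@fdiff int) h 0)%:~R / d`!%:R &
    forall j, (j < n)%N -> f.[j%:R] = (h j)%:~R].
Proof.
move=> h0; exists (newton_poly (fun j => (h j)%:~R) d).
split; first exact: size_newton_poly.
  by rewrite coef_newton_poly (raddf_iter_fdiff (intmul 1)).
move=> j jn; rewrite horner_newton_poly // => i /andP[di ij].
by rewrite (raddf_iter_fdiff (intmul 1)) h0 ?mulr0z // di (leq_ltn_trans ij).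
Qed.

(** * The case n = d + 6 *)

Definition delta (m j : nat) : int := (j == m)%:R.

(** Differencing a spike at m + 1 gives a spike at m minus a spike at m + 1; Pascal's rule does the
    rest. *)
Lemma iter_fdiff_delta (m i : nat) :
  iter i (@fdiff int) (delta m) 0 = (-1) ^+ (i + m) *+ 'C(i, m).
Proof.
elim: i m => [|i IH] [|m]; rewrite ?iterSr.
- by [].
- by rewrite bin0n mulr0n.
- rewrite (@eq_fdiff _ _ (fun j => - delta 0 j)).
    by rewrite (raddf_iter_fdiff -%R) IH !addn0 !bin0 !mulr1n exprS mulN1r.
  by move=> j; rewrite /fdiff /delta /= sub0r.
rewrite (@eq_fdiff _ _ (fun j => delta m j + - delta m.+1 j)); last first.
  by move=> j; rewrite /fdiff /delta eqSS.
rewrite iter_fdiffD (raddf_iter_fdiff -%R) !IH binS mulrnDr addrC.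
by rewrite addSn addnS !exprS !mulN1r opprK mulNrn [X in X + _ = _]opprK.
Qed.

(* The 6-periodic sequence 0, 1, 1, 0, -1, -1, i.e. (2 / sqrt 3) sin (pi j / 3):
   since |exp(i pi / 3) - 1| = 1, its iterated differences do not grow. *)
Definition hexagon (j : nat) : int := nth 0 [:: 0; 1; 1; 0; -1; -1] (j %% 6).

Lemma hexagon_add3 j : hexagon (j + 3) = - hexagon j.
Proof.
rewrite /hexagon -modnDml; have : (j %% 6 < 6)%N by rewrite ltn_mod.
by case: (j %% 6)%N => [|[|[|[|[|[|]]]]]].
Qed.

Lemma hexagon_mul3_add k r : hexagon (3 * k + r) = (-1) ^+ k * hexagon r.
Proof.
elim: k => [|k IH]; first by rewrite mul1r.
rewrite (_ : (3 * k.+1 + r = 3 * k + r + 3)%N); last by lia.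
by rewrite hexagon_add3 IH exprS mulN1r mulNr.
Qed.

(** A primitive sixth root of unity z satisfies z - 1 = z^2, so differencing amounts to a shift by
    two. *)
Lemma fdiff_hexagon j : hexagon j.+1 - hexagon j = hexagon j.+2.
Proof.
rewrite /hexagon -[j.+2]addn2 -[j.+1]addn1 -(modnDml j 1) -(modnDml j 2).
have : (j %% 6 < 6)%N by rewrite ltn_mod.
by case: (j %% 6)%N => [|[|[|[|[|[|]]]]]].
Qed.

Lemma iter_fdiff_hexagon s i j :
  iter i (@fdiff int) (fun k => hexagon (k + s)) j = hexagon (j + s + 2 * i).
Proof.
elim: i j => [|i IH] j /=; first by rewrite muln0 addn0.
by rewrite /fdiff !IH !addSn fdiff_hexagon; congr hexagon; lia.
Qed.

Lemma hexagon_bounds j : -1 <= hexagon j <= 1.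
Proof.
rewrite /hexagon; have : (j %% 6 < 6)%N by rewrite ltn_mod.
by case: (j %% 6)%N => [|[|[|[|[|[|]]]]]].
Qed.

(* The k-th difference of [delta m] at 0 is, up to sign, 'C(k, m), so below order
   d + 4 the spikes contribute (-1) ^ k (d + 2 - k). For k = d+1, d+2, d+3 this is
   1, 0, -1 up to a common sign, which the hexagonal sequence cancels; the spikes at
   d + 4 and d + 5 then correct the orders d + 4 and d + 5. *)
Definition spike (d j : nat) : int :=
  (d.+2%:R * (delta 0 j + (-1) ^+ d * delta (d + 5) j)
   + (delta 1 j + (-1) ^+ d * delta (d + 4) j)) + hexagon (j + (d + 5)).

Lemma iter_fdiff_spike (d i : nat) : iter i (@fdiff int) (spike d) 0 =
  (d.+2%:R * ((-1) ^+ i + (-1) ^+ d * (-1) ^+ (i + (d + 5)) *+ 'C(i, d + 5))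
  + ((-1) ^+ i.+1 *+ i + (-1) ^+ d * (-1) ^+ (i + (d + 4)) *+ 'C(i, d + 4)))
  + hexagon (d + 5 + 2 * i).
Proof.
rewrite /spike iter_fdiffD iter_fdiff_hexagon add0n; congr (_ + _).
rewrite iter_fdiffD iter_fdiffMl !iter_fdiffD !iter_fdiffMl !iter_fdiff_delta.
by rewrite bin0 bin1 addn0 addn1 mulr1n !mulrnAr.
Qed.

Lemma spike_vanish (d i : nat) : (d < i < d + 6)%N ->
  iter i (@fdiff int) (spike d) 0 = 0.
Proof.
case/andP=> di id.
have [k k5 ->] : exists2 k, (k < 5)%N & i = (d + k.+1)%N.
  by exists (i - d.+1)%N; lia.
have sq : (-1) ^+ d * (-1) ^+ d = 1 :> int by rewrite -expr2 sqrr_sign.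
rewrite iter_fdiff_spike.
rewrite (_ : (d + 5 + 2 * (d + k.+1)) = (3 * d + (2 * k + 7)))%N; last by lia.
rewrite hexagon_mul3_add.
rewrite -!exprD.
have hx m r : m = (d + r)%N -> (-1) ^+ m = (-1) ^+ d * (-1) ^+ r :> int.
  by move=> ->; rewrite exprD.
have hx2 m r : m = (d + (d + d) + r)%N -> (-1) ^+ m = (-1) ^+ d * (-1) ^+ r :> int.
  by move=> ->; rewrite !exprD sq mulr1.
rewrite (hx (d + k.+1)%N k.+1) // (hx (d + k.+1).+1 k.+2); last by lia.
have d2 : d.+2%:R = d%:R + 2 :> int by lia.
have bs r s : (r < s)%N -> 'C(d + r, d + s) = 0%N.
  by move=> rs; rewrite bin_small // ltn_add2l.
(* Orders d+1 to d+5 in turn: the far spikes are absent from the first three, only the one at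
   [d + 4] enters the fourth, and both enter the last. *)
case: k k5 => [|[|[|[|[|//]]]]] _; rewrite /= d2 /hexagon /=.
- by rewrite !bs // -(mulr_natr ((-1) ^+ d * _)) natrD; ring.
- by rewrite !bs // -(mulr_natr ((-1) ^+ d * _)) natrD; ring.
- by rewrite !bs // -(mulr_natr ((-1) ^+ d * _)) natrD; ring.
- rewrite (bs 4%N 5%N) // binn -(mulr_natr ((-1) ^+ d * _)) natrD.
  by rewrite (hx2 (d + (d + 4 + (d + 4)))%N 8%N); [ring|lia].
rewrite binn (_ : 'C(d + 5, d + 4) = d + 5)%N; last by rewrite !addnS binSn.
rewrite (hx2 (d + (d + 5 + (d + 5)))%N 10%N); last by lia.
rewrite (hx2 (d + (d + 5 + (d + 4)))%N 9%N); last by lia.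
rewrite -!(mulr_natr ((-1) ^+ d * _) (d + 5)) natrD.
ring.
Qed.

(** At order [d] the near spikes give 2 (-1)^d and the hexagon gives -(-1)^d, leaving (-1)^d. This
    makes the degree of the interpolant exact. *)
Lemma spike_nonvanish (d : nat) : iter d (@fdiff int) (spike d) 0 != 0.
Proof.
rewrite iter_fdiff_spike (@bin_small d (d + 5)) ?(@bin_small d (d + 4)); try lia.
rewrite (_ : (d + 5 + 2 * d = 3 * d + 5)%N) ?hexagon_mul3_add; last by lia.
have d2 : d.+2%:R = d%:R + 2 :> int by lia.
rewrite exprS mulN1r d2 -(mulr_natr (- _)) /hexagon /=.
rewrite (_ : _ + _ = (-1) ^+ d); first by rewrite signr_eq0.
ring.
Qed.

(** The added term is affine in [j], hence invisible to differences of order at least 2. For even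
    [d] the large spikes are positive and 1 absorbs the hexagon; for odd [d] the spike at [d + 5] is
    negative and adding [j] lifts it. *)
Lemma spike_bounds (d j : nat) : (2 <= d)%N -> (j < d + 6)%N ->
  0 <= spike d j + (if odd d then j%:Z else 1) < (d + 5)%:Z.
Proof.
move=> d2 jd; rewrite /spike; have /andP[hl hu] := hexagon_bounds (j + (d + 5)).
set w := hexagon _ in hl hu *; rewrite -signr_odd /delta.
case: ifP => dodd; rewrite ?expr0 ?expr1.
  have d3 : (2 < d)%N.
    by rewrite ltn_neqAle d2 andbT; apply: contraL dodd => /eqP <-.
  have [j0|j0] := eqVneq j 0%N; have [j1|j1] := eqVneq j 1%N;
  have [j4|j4] := eqVneq j (d + 4)%N; have [j5|j5] := eqVneq j (d + 5)%N;
  rewrite /=; lia.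
have [j0|j0] := eqVneq j 0%N; have [j1|j1] := eqVneq j 1%N;
have [j4|j4] := eqVneq j (d + 4)%N; have [j5|j5] := eqVneq j (d + 5)%N;
rewrite /=; lia.
Qed.

Lemma nat_range_poly_exact_degree (F : numFieldType) (d : nat) : (2 <= d)%N ->
  exists2 f : {poly F}, deg f = d &
    forall j, (j < d + 6)%N -> exists2 i, (i < d + 5)%N & f.[j%:R] = i%:R.
Proof.
move=> d2; pose l j := if odd d then j%:Z else 1.
have l2 i : (1 < i)%N -> iter i (@fdiff int) l 0 = 0.
  move=> i1; rewrite -(subnKC i1); apply: (@iter_fdiff_vanish _ _ _ i); last first.
    by lia.
  by move=> k _; rewrite /= /fdiff /l; case: ifP; lia.
have [|f [sf fd fE]] := @int_newton_poly F (fun j => spike d j + l j) (d + 6) d.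
  move=> i di; rewrite iter_fdiffD spike_vanish // l2 //.
  by case/andP: di => [/(leq_ltn_trans d2)/ltnW].
exists f.
  have sfd : (d < size f)%N.
    rewrite ltnNge; apply/negP => /leq_sizeP/(_ d (leqnn d)) /eqP.
    rewrite fd mulf_eq0 invr_eq0 pnatr_eq0 gtn_eqF ?fact_gt0 // orbF intr_eq0.
    by rewrite iter_fdiffD l2 // addr0 (negPf (spike_nonvanish d)).
  by rewrite /deg (_ : size f = d.+1) //; apply/eqP; rewrite eqn_leq sf.
move=> j jd; rewrite fE //; have := spike_bounds d2 jd; rewrite -/(l j).
case: (_ + _) => // i /andP[_ id]; by exists i.
Qed.

(** * The case n = d + log2 d *)

(** The inequality of arithmetic and geometric means for [q] twos and [P - q] ones. *)
Lemma expn_AGM (P q : nat) : (q <= P)%N -> (2 ^ q * P ^ P <= (P + q) ^ P)%N.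
Proof.
move=> qP; pose E (i : 'I_P) : int := if (i < q)%N then 2 else 1.
have E0 : {in predT, forall i, 0 <= E i *+ #|'I_P|}.
  by move=> i _; rewrite mulrn_wge0 // /E; case: ifP.
have prodE : \prod_(i < P | (i < q)%N) (2 : int) = 2 ^+ q.
  by rewrite -(big_ord_widen P (fun=> 2 : int)) // prodr_const card_ord.
have sumE : \sum_(i < P | (i < q)%N) (1 : int) = q%:R.
  by rewrite -(big_ord_widen P (fun=> 1 : int)) // sumr_const card_ord.
have := (leif_AGM_scaled E0).1; rewrite prodrMn_const card_ord.
have -> : \prod_i E i = 2 ^+ q.
  by rewrite -prodE [RHS]big_mkcond.
have -> : \sum_i E i = (P + q)%:R.
  rewrite natrD -sumE.
  have <- : \sum_(i < P) (1 : int) = P%:R by rewrite sumr_const card_ord.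
  rewrite [X in _ + X]big_mkcond -big_split /=.
  by apply: eq_bigr => i _; rewrite /E /=; case: ifP.
by rewrite -!natrX -mulrnA ler_nat.
Qed.

(* With P = 2 ^ l.-1 and q = l./2 the base is at least P + q, and d >= 2 P. *)
Lemma expn_half_log (d l : nat) : (0 < l)%N -> (2 ^ l <= d)%N ->
  (2 ^ (l.-1 * d.+1) <= ((d + l)./2) ^ d)%N.
Proof.
case: l => // l _ ld; set P := (2 ^ l)%N; set q := (l.+1)./2.
have Pd : (2 * P <= d)%N by rewrite -expnS.
have qP : (q <= P)%N.
  have : (l < P)%N by apply: ltn_expl.
  by rewrite /q; lia.
have PqM : (P + q <= (d + l.+1)./2)%N by rewrite /q; lia.
apply: (@leq_trans ((P + q) ^ d)); last by rewrite leq_exp2r //; lia.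
(* The surplus factor [P] in [P ^ d.+1] is at most [2 ^ (2 * q)], which [expn_AGM], squared,
   extracts from [2 * P] of the [d] factors on the right. *)
rewrite expnM -/P -(subnKC Pd) -addnS expnD expnS expnD.
apply: (@leq_trans ((2 ^ q * P ^ P) ^ 2 * P ^ (d - 2 * P))).
  rewrite mulnA leq_mul2r; apply/orP; right.
  rewrite expnMn -!expnM (mulnC P 2) mulnC leq_mul2r; apply/orP; right.
  by rewrite leq_exp2l //; rewrite /q; lia.
apply: leq_mul; last by case: (d - _)%N => // e; rewrite leq_exp2r ?leq_addr.
by rewrite (mulnC 2) [X in (_ <= X)%N]expnM leq_exp2r // expn_AGM.
Qed.

(** A first difference of values in [0, B] is at most B, not 2B, in absolute value; each later order
    at most doubles the bound. *)
Lemma fdiff_bound (h : nat -> int) (B : int) (m k : nat) :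
  (forall j, 0 <= h j <= B) -> `|iter m.+1 (@fdiff int) h k| <= B * 2 ^+ m.
Proof.
move=> hB; elim: m k => [|m IH] k.
  by have := hB k; have := hB k.+1; rewrite /= /fdiff; lia.
rewrite iterS /fdiff; have := IH k.+1; have := IH k.
rewrite exprS mulrCA; set x := iter _ _ _ _; set y := iter _ _ _ _.
by set z := B * _; lia.
Qed.

(* Pigeonhole on the differences of order d.+1 at 0, ..., l - 2 of the sequences
   with values in {0, ..., m}; requiring h 0 = 0 rules out constant solutions. *)
Lemma small_integer_polynomial (d l m : nat) :
  (1 < l)%N -> (2 ^ (l.-1 * d.+1) <= m.+1 ^ d)%N ->
  exists h : nat -> int, [/\ h 0%N = 0, exists2 j, (j < d + l)%N & h j != 0,
    forall j, `|h j| <= m%:Z &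
    forall i, (d < i < d + l)%N -> iter i (@fdiff int) h 0 = 0].
Proof.
case: l => [|[|l]] // _; rewrite [l.+2.-1]/= => dm.
(* [u] fills the positions 1 to [d + l.+1]; zero elsewhere keeps the bounds valid for every
   index. *)
pose ext (u : {ffun 'I_(d + l.+1) -> 'I_m.+1}) (j : nat) : int :=
  if j is j'.+1 then if insub j' is Some r then (u r : nat)%:Z else 0 else 0.
have ext_ge0 u j : 0 <= ext u j <= m%:Z.
  by case: j => [|j] //=; case: insub => // r; have := ltn_ord (u r); lia.
have ext_bound u k : `|iter d.+1 (@fdiff int) (ext u) k| <= (m * 2 ^ d)%:Z.
  by rewrite PoszM -(natz (2 ^ d)) natrX; apply: fdiff_bound.
(* Shifted by [m * 2 ^ d], the differences lie in [0, N]. There are [N.+1 ^ l.+1] boxes for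
   [m.+1 ^ (d + l.+1)] sequences. *)
pose N := (m * 2 ^ d.+1)%N.
pose box u : {ffun 'I_l.+1 -> 'I_N.+1} := [ffun k : 'I_l.+1 =>
  inord (absz (iter d.+1 (@fdiff int) (ext u) k + (m * 2 ^ d)%:Z))].
have /injectivePn[u [v uv boxuv]] : ~~ injectiveb box.
  apply/negP => /injectiveP /leq_card; rewrite !card_ffun !card_ord.
  apply/negP; rewrite -ltnNge expnD.
  apply: (@leq_trans ((m.+1 * 2 ^ d.+1) ^ l.+1)).
    have : (1 < 2 ^ d.+1)%N by rewrite -(expn0 2) ltn_exp2l.
    by rewrite ltn_exp2r // /N mulSn; lia.
  by rewrite expnMn mulnC leq_mul2r -expnM mulnC dm orbT.
exists (fun j => ext u j - ext v j); split => //.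
- have [r uvr] : exists r, u r != v r.
    apply/existsP; apply: contraR uv; rewrite negb_exists => /forallP uv.
    by apply/eqP/ffunP => r; have := uv r; rewrite negbK => /eqP.
  exists r.+1; first by have := ltn_ord r; lia.
  by rewrite /ext valK subr_eq0 eqz_nat (inj_eq val_inj).
- by move=> j; have := ext_ge0 u j; have := ext_ge0 v j; lia.
move=> i /andP[di il]; rewrite -(subnKC di).
apply: (@iter_fdiff_vanish _ _ _ l.+1); last by lia.
move=> k kl; rewrite iter_fdiffD (raddf_iter_fdiff -%R); apply/eqP.
have := congr1 (fun b : {ffun 'I_l.+1 -> 'I_N.+1} => b (Ordinal kl) : nat) boxuv.
have := ext_bound u k; have := ext_bound v k; rewrite !ffunE.
set a := iter _ _ _ _; set b := iter _ _ _ _ => ba bb; rewrite !inordK.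
- by rewrite subr_eq0; lia.
- by rewrite /N expnS; lia.
by rewrite /N expnS; lia.
Qed.

Lemma deg_bounds (F : fieldType) (f : {poly F}) (m n : nat) :
  (m < size f)%N -> (size f <= n.+1)%N -> (m <= deg f <= n)%N.
Proof. by rewrite /deg; case: (size f) => //= k mk kn; rewrite -ltnS mk. Qed.

Lemma horner_affine (F : fieldType) (f : {poly F}) (x : F) :
  (size f <= 2)%N -> f.[x] = f.[0] + (f.[1] - f.[0]) * x.
Proof.
move=> f2; rewrite !(horner_coef_wide _ f2) !big_ord_recr !big_ord0 /=.
by rewrite !expr0 !expr1; ring.
Qed.

Lemma nat_range_poly_log (F : numFieldType) (d l : nat) :
  (1 < l)%N -> (2 ^ l <= d)%N ->
  exists2 f : {poly F}, (2 <= deg f <= d)%N &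
    forall j, (j < d + l)%N -> exists2 i, (i < (d + l).-1)%N & f.[j%:R] = i%:R.
Proof.
move=> l1 ld; have d4 : (4 <= d)%N.
  by apply: leq_trans ld; rewrite -[4%N]/(2 ^ 2)%N leq_exp2l.
pose m := ((d + l)./2).-1.
have [|h [h0 [j0 j0n hj0] hm hd]] := @small_integer_polynomial d l m l1.
  rewrite /m prednK; first by rewrite expn_half_log // ltnW.
  by rewrite half_gt0; lia.
have [|f [sf _ fE]] := @int_newton_poly F (fun j => h j + m%:Z) (d + l) d.
  move=> i idl; rewrite iter_fdiffD hd // add0r.
  have /andP[di _] := idl; rewrite -(@subnKC 1 i); last by lia.
  by apply: (@iter_fdiff_vanish _ _ _ i); [move=> k _; rewrite /= /fdiff subrr|lia].
exists f; last first.
  move=> j jn; rewrite fE //; have := hm j.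
  have : (m + m < (d + l).-1)%N by rewrite /m; lia.
  move=> mdl hjm; exists (absz (h j + m%:Z)); first by lia.
  by rewrite [RHS]pmulrn gez0_abs //; lia.
suff f2 : (2 < size f)%N by apply: deg_bounds.
rewrite ltnNge; apply/negP => f2.
have hE j : (j < d + l)%N -> h j = h 1%N * j%:Z.
  move=> jn; have := horner_affine j%:R f2.
  rewrite -[1]/(1%:R) -[0]/(0%:R) !fE; try lia.
  rewrite h0 [j%:R]pmulrn -intrB -intrM -intrD => /eqP; rewrite eqr_int.
  by move=> /eqP hjE; apply: (addIr m%:Z); rewrite hjE; ring.
(* A nonzero integer slope would make |h| at least [(d + l).-1] at the last point, exceeding [m]. *)
have h1 : h 1%N = 0.
  have := hm (d + l).-1; rewrite hE ?normrM; last by lia.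
  have -> : `|((d + l).-1)%:Z| = (d + l).-1%:Z by lia.
  have [-> //|h1 H] := eqVneq (h 1%N) 0.
  suff : `|h 1%N| * (d + l).-1%:Z >= (d + l).-1%:Z by rewrite /m in H; lia.
  by rewrite ler_peMl //; lia.
by move: hj0; rewrite hE // h1 mul0r eqxx.
Qed.

(* Sampling f with step s multiplies its top difference, a nonzero integer, by
   s ^ deg f. *)
Lemma nat_range_deg_lower (F : numFieldType) (f : {poly F}) (n s : nat) :
  (0 < deg f)%N -> (s * deg f < n)%N ->
  (forall j, (j < n)%N -> exists2 i, (i < n)%N & f.[j%:R] = i%:R) ->
  (s ^ deg f <= n * 2 ^ (deg f).-1)%N.
Proof.
set k := deg f => k0 skn fn.
have [->|s0] := posnP s; first by rewrite exp0n.
have /choice[u uP] : forall j, exists i,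
    (i < n)%N /\ ((j < n)%N -> f.[j%:R] = i%:R).
  move=> j; have [jn|nj] := ltnP j n.
    by have [i ni fj] := fn j jn; exists i.
  by exists 0%N; split=> //; lia.
have sf : (size f <= k.+1)%N by apply: leqSpred.
have fk0 : f`_k != 0.
  rewrite /k /deg -lead_coefE lead_coef_eq0; apply/eqP => f0.
  by move: k0; rewrite /k /deg f0 size_poly0.
pose c := iter k (@fdiff int) (fun j => (u j)%:Z) 0.
have cE : c%:~R = f`_k *+ k`! :> F.
  rewrite -(iter_fdiff_horner sf) /c -(raddf_iter_fdiff (intmul 1)).
  apply: eq_in_fdiff => j /andP[_ jk]; rewrite (uP j).2 ?pmulrn //.
  by apply: leq_ltn_trans skn; rewrite (leq_trans jk) ?leq_pmull.
have c0 : c != 0.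
  by rewrite -(intr_eq0 F) cE mulrn_eq0 negb_or fk0 -lt0n fact_gt0.
pose g : {poly F} := \poly_(i < k.+1) (f`_i * s%:R ^+ i).
have gE j : g.[j%:R] = f.[(s * j)%:R].
  rewrite horner_poly (horner_coef_wide _ sf); apply: eq_bigr => i _.
  by rewrite natrM exprMn mulrA.
have scE : c * (s ^ k)%:Z = iter k (@fdiff int) (fun j => (u (s * j)%N)%:Z) 0.
  apply: (@intr_inj F); rewrite -(raddf_iter_fdiff (intmul 1)).
  rewrite (@eq_in_fdiff _ _ (fun j => g.[j%:R])).
    rewrite iter_fdiff_horner ?size_poly // coef_poly ltnSn intrM cE.
    by rewrite mulrnAl -pmulrn natrX.
  move=> j /andP[_ jk]; rewrite gE (uP _).2 ?pmulrn //.
  by apply: leq_ltn_trans skn; rewrite leq_mul2l jk orbT.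
rewrite -lez_nat PoszM -(natz (2 ^ _)) natrX.
apply: (@le_trans _ _ `|c * (s ^ k)%:Z|).
  by rewrite normrM ler_peMl //; lia.
rewrite scE -(prednK k0); apply: fdiff_bound => j.
by have [] := uP (s * j)%N; lia.
Qed.

(** If [2 <= deg f <= D], the step [s], about n / D, is at least [4 * D]; then [2 * n < s ^ 2], and
    [s ^ deg f] exceeds the bound of [nat_range_deg_lower]. *)
Lemma nat_range_deg_large (F : numFieldType) (f : {poly F}) (n D : nat) :
  (2 <= deg f)%N -> (4 * D ^ 2 < n)%N ->
  (forall j, (j < n)%N -> exists2 i, (i < n)%N & f.[j%:R] = i%:R) ->
  (D < deg f)%N.
Proof.
move=> f2 Dn fn; rewrite ltnNge; apply/negP => fD.
have D0 : (0 < D)%N by apply: leq_trans fD; apply: ltnW.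
pose s := (n.-1 %/ D)%N.
have sD : (s * D <= n.-1)%N by rewrite leq_divM.
have sn : (n.-1 < s.+1 * D)%N by rewrite ltn_ceil.
have s4D : (4 * D <= s)%N by rewrite leq_divRL // -mulnA mulnn; lia.
have sfn : (s * deg f < n)%N.
  have : (s * deg f <= s * D)%N by rewrite leq_mul2l fD orbT.
  by lia.
have := nat_range_deg_lower (ltnW f2) sfn fn.
apply/negP; rewrite -ltnNge; have [e ->] : exists e, deg f = e.+2.
  by exists (deg f - 2)%N; lia.
rewrite /= !expnS !mulnA.
have se : (2 ^ e <= s ^ e)%N by case: (e) => // e'; rewrite leq_exp2r //; lia.
have ns : (n * 2 < s * s)%N by nia.
apply: (@leq_trans (s * s * 2 ^ e)); last by rewrite leq_mul2l se orbT.
by rewrite ltn_mul2r expn_gt0 ns.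
Qed.

(** * Logarithm estimates and assembly of the bounds *)

Lemma floor_log2_lt (R : realType) (x : R) (l : nat) :
  0 < x -> x < 2 ^+ l -> Num.floor (log2 x) < l%:Z.
Proof.
move=> x0 xl; have ln2 : 0 < ln 2 :> R by rewrite ln_gt0 // ltr1n.
rewrite floor_lt_int /log2 ltr_pdivrMr //.
rewrite -[X in X * _]pmulrn mulr_natl -lnXn // ltr_ln // posrE exprn_gt0 //.
Qed.

Lemma unbounded_infinite_nat (A : set nat) :
  (forall D, exists2 d, A d & (D < d)%N) -> infinite_set A.
Proof.
move=> AD /finite_seqP[s As]; have [d Ad] := AD (\max_(i <- s) i)%N.
by rewrite ltnNge leq_bigmax_seq //; move: Ad; rewrite As.
Qed.

Theorem corollary1p4 (R : realType) :
  (forall d : nat, (2 <= d)%N ->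
     ((d%:Z + Num.max 6 (Num.floor (log2 (d%:R : R))))%:~R%:E <= Bsup R d)%E /\
     ((d ^ 2 + 4 * d + 1)%N%:R%:E <= Csup R d)%E) /\
  infinite_set [set d : nat | (2 <= d)%N /\
     ((d%:Z ^+ 2 + d%:Z * Num.floor (log2 (d%:R / 4 : R)) + 1)%:~R%:E
        <= Csup R d)%E].
Proof.
split=> [d d2|].
  split; last first.
    have [f fd fn] := @nat_range_poly_exact_degree R[i] d d2.
    (* The count is d (d + 5) - (d - 1) = d^2 + 4d + 1. *)
    apply: (@Csup_ge R d (d + 5) _ f); first by rewrite fd d2 leqnn.
      by move=> j jd; apply: fn; rewrite addnS ltnS.
    by rewrite fd; lia.
  pose l := trunc_log 2 d.
  have d0 : (0 < d)%N by apply: ltnW.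
  have fl : Num.floor (log2 (d%:R : R)) <= l%:Z.
    rewrite -ltzD1 -[l%:Z + 1]/(l + 1)%:Z addn1.
    by apply: floor_log2_lt; rewrite ?ltr0n // -natrX ltr_nat trunc_log_ltn.
  apply: (@le_trans _ _ (d + maxn 6 l)%:R%:E).
    rewrite lee_fin [leRHS]pmulrn ler_int PoszD lerD2l ge_max; lia.
  have [l6|l6] := leqP l 6.
    have [f fd fn] := @nat_range_poly_exact_degree rat d d2.
    apply: (@Bsup_ge R d _ f); first by rewrite fd d2 leqnn.
    move=> j jd; have [i id ->] := fn j jd; exists i => //; lia.
  have [||f fd fn] := @nat_range_poly_log rat d l; first by lia.
    by rewrite trunc_logP.
  apply: (@Bsup_ge R d _ f) => // j jd.
  by have [i id ->] := fn j jd; exists i => //; lia.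
apply: unbounded_infinite_nat => D.
(* This [l] makes [d + l] exceed [4 * D ^ 2], forcing degree above [D]. The witness is [deg f],
   which may be less than [d]. *)
pose l := (4 * D ^ 2 + 2)%N; pose d := (2 ^ l)%N.
have [||f /andP[f2 fd] fn] := @nat_range_poly_log R[i] d l; first by lia.
  by [].
have fD : (D < deg f)%N.
  apply: (@nat_range_deg_large _ _ (d + l)) => //; first by rewrite /l; lia.
  by move=> j jn; have [i ni ->] := fn j jn; exists i => //; lia.
exists (deg f) => //; split=> //.
(* Since deg f / 4 <= 2^(l-2) < 2^(l-1), the floor is at most [l - 2]; with [deg f <= d] this gives
   deg f + floor <= d + l - 2. *)
have fl : Num.floor (log2 ((deg f)%:R / 4 : R)) < l.-1%:Z.
  apply: floor_log2_lt; first by rewrite divr_gt0 // ltr0n; lia.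
  rewrite ltr_pdivrMr // -natrX -natrM ltr_nat.
  apply: leq_ltn_trans fd _; rewrite /d /l addn2 /= !expnS.
  by have := expn_gt0 2 (4 * D ^ 2); lia.
apply: (@le_trans _ _ (deg f * (d + l - 2) + 1)%:R%:E).
  rewrite lee_fin [leRHS]pmulrn ler_int PoszD lerD2r PoszM expr2 -mulrDr.
  by rewrite ler_wpM2l //; lia.
apply: (@Csup_ge R _ (d + l).-1 _ f); first by rewrite f2 leqnn.
  by move=> j jd; apply: fn; lia.
rewrite (_ : (d + l).-1 = (d + l - 2).+1); last by rewrite /l; lia.
by rewrite mulnS addnAC (addnC (deg f)).
Qed.
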